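(* Let $n>1$ and $\lambda\in F$ (the case $\lambda=0$ being allowed). A representation $R_{a,b,c,M,N,\alpha}$ of $\mathfrak g$ is faithful if and only if $$(a,b,c)\in\{(n,1,n),(n-1,2,n-1),(n,1,n-1),(n-1,1,n)\}.$$
   Context: $F$ is an algebraically closed field of characteristic $0$; all Lie algebras and representations are finite dimensional over $F$. $M_{p\times q}$ is the space of $p\times q$ matrices over $F$, and $\mathfrak{gl}(d)$ is the Lie algebra of $d\times d$ matrices over $F$. The Lie algebra $\mathfrak g$. Let $V$ be an $F$-vector space of dimension $n>1$ with basis $v_0,\dots,v_{n-1}$. $L(V)=V\oplus\Lambda^2(V)$ is the free 2-step nilpotent Lie algebra: $[v,w]=v\wedge w$ and $[u,v\wedge w]=0$ for $u,v,w\in V$ (and $[\Lambda^2(V),\Lambda^2(V)]=0$). Then $\mathfrak g=\langle x\rangle\ltimes L(V)$, where $x$ acts on $V$ by $[x,v_i]=\lambda v_i+v_{i+1}$ for $0\le i\le n-2$ and $[x,v_{n-1}]=\lambda v_{n-1}$, and on $\Lambda^2(V)$ by $[x,v\wedge w]=[x,v]\wedge w+v\wedge[x,w]$. The representations $R_{a,b,c,M,N,\alpha}$. Let $(a,b,c)$ be positive integers with ($a+b=n+1$ and $c\le a$) or ($c+b=n+1$ and $a\le c$); let $M\in M_{a\times b}$, $N\in M_{b\times c}$ with $M_{a,1}\ne0$, $N_{b,1}\neq0$; let $\alpha\in F$. With $J^p(\beta)$ the upper triangular Jordan block of size $p$ and eigenvalue $\beta$, the representation $R=R_{a,b,c,M,N,\alpha}:\mathfrak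 g\to\mathfrak{gl}(d)$, $d=a+b+c$, is given in block form (block sizes $a,b,c$) by $$R(x)=A=\begin{pmatrix}J^a(\alpha)&0&0\\0&J^b(\alpha-\lambda)&0\\0&0&J^c(\alpha-2\lambda)\end{pmatrix},$$ $$R(v_k)=(\mathrm{ad}_{\mathfrak{gl}(d)}A-\lambda 1_{\mathfrak{gl}(d)})^k\begin{pmatrix}0&M&0\\0&0&N\\0&0&0\end{pmatrix},\quad 0\le k\le n-1,$$ $$R(v\wedge w)=[R(v),R(w)],\quad v,w\in V.$$ *)

(* Defs.v *)
From HB Require Import structures.
From mathcomp Require Import all_boot all_order all_algebra.
From mathcomp Require Import ring zify.

Set Implicit Arguments.
Unset Strict Implicit.
Unset Printing Implicit Defensive.

Import GRing.Theory.
Local Open Scope ring_scope.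

HB.mixin Record Lmodule_isLieAlgebra (F : fieldType) L
    & GRing.Lmodule F L := {
  lie_bracket : L -> L -> L;
  lie_bracketDl : forall (k : F) (u v w : L),
    lie_bracket (k *: u + v) w = k *: lie_bracket u w + lie_bracket v w;
  lie_bracketDr : forall (k : F) (u v w : L),
    lie_bracket u (k *: v + w) = k *: lie_bracket u v + lie_bracket u w;
  lie_bracketxx : forall u : L, lie_bracket u u = 0;
  lie_jacobi : forall u v w : L,
    lie_bracket u (lie_bracket v w) + lie_bracket v (lie_bracket w u)
      + lie_bracket w (lie_bracket u v) = 0
}.

#[short(type="lieAlgType")]
HB.structure Definition LieAlgebra (F : fieldType) :=
  { L of Lmodule_isLieAlgebra F L & GRing.Lmodule F L }.

Definition mxcomm (F : fieldType) (d : nat) (A B : 'M[F]_d) : 'M[F]_d :=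
  A *m B - B *m A.

Record representation (F : fieldType) (L : lieAlgType F) (d : nat) := Repr {
  repr_fun :> {linear L -> 'M[F]_d};
  repr_bracket : forall u v : L,
    repr_fun (lie_bracket u v) = mxcomm (repr_fun u) (repr_fun v)
}.

Definition faithful (F : fieldType) (L : lieAlgType F) (d : nat)
  (R : representation L d) : Prop := injective R.

Definition first_ord (p : nat) (hp : (0 < p)%N) : 'I_p := Ordinal hp.
Definition last_ord (p : nat) (hp : (0 < p)%N) : 'I_p := rev_ord (Ordinal hp).

Definition jordan (F : fieldType) (p : nat) (beta : F) : 'M[F]_p :=
  \matrix_(i < p, j < p) (beta *+ (i == j) + (j == i.+1 :> nat)%:R).

(* V is 'rV_n, with v_i the i-th unit row vector. *)
Definition basisV (F : fieldType) (n : nat) (i : 'I_n) : 'rV[F]_n :=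
  delta_mx 0 i.

(* The exterior square of V: coordinates in the basis (v_i /\ v_j), i < j. *)
Definition ltpair (n : nat) := {p : 'I_n * 'I_n | (p.1 < p.2)%N}.
Definition ext2 (F : fieldType) (n : nat) := {ffun ltpair n -> F^o}.

Definition wedge (F : fieldType) (n : nat) (v w : 'rV[F]_n) : ext2 F n :=
  [ffun p => v 0 (val p).1 * w 0 (val p).2 - v 0 (val p).2 * w 0 (val p).1].

(* The linear map on the exterior square determined by v /\ w |-> B v w, for an
   alternating bilinear B; see ext2_lift_wedge. *)
Definition ext2_lift (F : fieldType) (n : nat) (W : lmodType F)
    (B : 'rV[F]_n -> 'rV[F]_n -> W) (s : ext2 F n) : W :=
  \sum_p s p *: B (basisV F (val p).1) (basisV F (val p).2).

Definition adV (F : fieldType) (n : nat) (lambda : F) (v : 'rV[F]_n) :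
  'rV[F]_n := v *m jordan n lambda.

Definition adL2 (F : fieldType) (n : nat) (lambda : F) : ext2 F n -> ext2 F n :=
  ext2_lift (fun v w => wedge (adV lambda v) w + wedge v (adV lambda w)).

Section Carrier.
Variables (F : fieldType) (n : nat) (lambda : F).

Lemma adV_basis (i : 'I_n) (hi : (i.+1 < n)%N) :
  adV lambda (basisV F i) = lambda *: basisV F i + basisV F (Ordinal hi).
Proof.
rewrite /adV /basisV -rowE; apply/rowP => j; rewrite !mxE /= eq_sym.
by rewrite -(inj_eq val_inj j (Ordinal hi)) /= mulr_natr.
Qed.

Lemma adV_basis_last (i : 'I_n) : i.+1 = n ->
  adV lambda (basisV F i) = lambda *: basisV F i.
Proof.
move=> hi; rewrite /adV /basisV -rowE; apply/rowP => j.
rewrite !mxE /= eq_sym hi mulr_natr.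
by rewrite (_ : (j == n :> nat) = false) ?addr0 // ltn_eqF.
Qed.

Lemma adV_is_linear k (v w : 'rV[F]_n) :
  adV lambda (k *: v + w) = k *: adV lambda v + adV lambda w.
Proof. by rewrite /adV mulmxDl scalemxAl. Qed.

Lemma ext2_addE (s t : ext2 F n) p : (s + t) p = s p + t p.
Proof. by rewrite ffunE. Qed.

Lemma ext2_oppE (s : ext2 F n) p : (- s) p = - s p.
Proof. by rewrite ffunE. Qed.

Lemma ext2_scaleE k (s : ext2 F n) p : (k *: s) p = k * s p.
Proof. by rewrite ffunE. Qed.

Lemma wedgeE (v w : 'rV[F]_n) p : wedge v w p =
  v 0 (val p).1 * w 0 (val p).2 - v 0 (val p).2 * w 0 (val p).1.
Proof. by rewrite ffunE. Qed.

Lemma wedge_linl k (u v w : 'rV[F]_n) :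
  wedge (k *: u + v) w = k *: wedge u w + wedge v w.
Proof. by apply/ffunP => p; rewrite !ffunE !mxE; rewrite /GRing.scale /=; ring. Qed.

Lemma wedge_linr k (u v w : 'rV[F]_n) :
  wedge u (k *: v + w) = k *: wedge u v + wedge u w.
Proof. by apply/ffunP => p; rewrite !ffunE !mxE; rewrite /GRing.scale /=; ring. Qed.

Lemma wedgexx (v : 'rV[F]_n) : wedge v v = 0.
Proof. by apply/ffunP => p; rewrite !ffunE; ring. Qed.

Lemma wedgeC (v w : 'rV[F]_n) : wedge v w = - wedge w v.
Proof. by apply/ffunP => p; rewrite !ffunE; ring. Qed.

Section Lift.
Variables (W : lmodType F) (B : 'rV[F]_n -> 'rV[F]_n -> W).

Lemma ext2_lift_linear k s t :
  ext2_lift B (k *: s + t) = k *: ext2_lift B s + ext2_lift B t.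
Proof.
rewrite /ext2_lift scaler_sumr -big_split; apply: eq_bigr => p _ /=.
by rewrite !ffunE scalerDl scalerA.
Qed.

Hypothesis Bl : forall k u v w, B (k *: u + v) w = k *: B u w + B v w.
Hypothesis Br : forall k u v w, B u (k *: v + w) = k *: B u v + B u w.
Hypothesis Bxx : forall u, B u u = 0.

Lemma ext2_lift_wedge v w : ext2_lift B (wedge v w) = B v w.
Proof.
have B0l u : B 0 u = 0.
  by have := Bl (-1) 0 0 u; rewrite scaler0 addr0 scaleN1r addNr.
have B0r u : B u 0 = 0.
  by have := Br (-1) u 0 0; rewrite scaler0 addr0 scaleN1r addNr.
have BC u u' : B u u' = - B u' u.
  apply/eqP; rewrite -addr_eq0; have := Bxx (1 *: u + u').
  by rewrite Bl !Br !Bxx !scale1r addr0 add0r => ->.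
have Suml (I : finType) (a : I -> F) (e : I -> 'rV_n) u :
    B (\sum_i a i *: e i) u = \sum_i a i *: B (e i) u.
  by elim/big_rec2: _ => [|i y1 y2 _ <-]; rewrite ?B0l ?Bl.
have Sumr (I : finType) (a : I -> F) (e : I -> 'rV_n) u :
    B u (\sum_i a i *: e i) = \sum_i a i *: B u (e i).
  by elim/big_rec2: _ => [|i y1 y2 _ <-]; rewrite ?B0r ?Br.
pose G i j := (v 0 i * w 0 j) *: B (basisV F i) (basisV F j).
have -> : B v w = \sum_i \sum_j G i j.
  rewrite {1}(row_sum_delta v) Suml; apply: eq_bigr => i _.
  rewrite {1}(row_sum_delta w) Sumr scaler_sumr.
  by apply: eq_bigr => j _; rewrite scalerA.
rewrite pair_big /=.
rewrite (bigID (fun p : 'I_n * 'I_n => (p.1 < p.2)%N)) /=.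
rewrite (bigID (fun p : 'I_n * 'I_n => (p.2 < p.1)%N) (fun p => ~~ _)) /=.
rewrite [X in _ + (_ + X)]big1 ?addr0; last first.
  move=> [i j] /= /andP[]; rewrite -!leqNgt => ij ji.
  have -> : i = j by apply/val_inj/eqP; rewrite eqn_leq ij ji.
  by rewrite /G Bxx scaler0.
have swap_inj : injective (fun p : 'I_n * 'I_n => (p.2, p.1)).
  by move=> [i j] [k l] /= [-> ->].
rewrite [X in _ + X](reindex_inj swap_inj) /=.
rewrite [X in _ + X](eq_bigl (fun p : 'I_n * 'I_n => (p.1 < p.2)%N)); last first.
  by move=> [i j] /=; case: (ltngtP i j).
rewrite -big_split /= /ext2_lift.
rewrite (reindex_omap (val : ltpair n -> _) insub) /=; last first.
  by move=> p pP; rewrite insubT.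
apply: eq_big => [p|p _]; first by rewrite valK eqxx andbT (valP p).
rewrite ffunE /G [B _ (basisV F (val p).1)]BC scalerN -scalerBl.
by congr ((_ - _) *: _); rewrite mulrC.
Qed.

End Lift.

Lemma adL2_wedge (v w : 'rV[F]_n) :
  adL2 lambda (wedge v w) = wedge (adV lambda v) w + wedge v (adV lambda w).
Proof.
apply: ext2_lift_wedge => [k x y z|k x y z|x].
- by rewrite adV_is_linear !wedge_linl scalerDr addrACA.
- by rewrite adV_is_linear !wedge_linr scalerDr addrACA.
- by rewrite [X in X + _]wedgeC addNr.
Qed.

End Carrier.

(* The Lie algebra g, an element (t, v, s) standing for t x + v + s. *)
Definition lie_g (F : fieldType) (n : nat) (lambda : F) : Type :=
  (F^o * 'rV[F]_n * ext2 F n)%type.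

HB.instance Definition _ (F : fieldType) (n : nat) (lambda : F) :=
  GRing.Lmodule.copy (lie_g n lambda) (F^o * 'rV[F]_n * ext2 F n)%type.

Definition bracket_g (F : fieldType) (n : nat) (lambda : F)
    (u w : lie_g n lambda) : lie_g n lambda :=
  let: (t, v, s) := u in let: (t', v', s') := w in
  (0, t *: adV lambda v' - t' *: adV lambda v,
   wedge v v' + (t *: adL2 lambda s' - t' *: adL2 lambda s)).

Section LieAxioms.
Variables (F : fieldType) (n : nat) (lambda : F).
Local Notation g := (lie_g n lambda).

Lemma bracket_gDl (k : F) (u v w : g) :
  bracket_g (k *: u + v) w = k *: bracket_g u w + bracket_g v w.
Proof.
move: u v w => [[t1 v1] s1] [[t2 v2] s2] [[t3 v3] s3].
have lin r (z z' : ext2 F n) :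
  adL2 lambda (r *: z + z') = r *: adL2 lambda z + adL2 lambda z'.
  exact: ext2_lift_linear.
rewrite /bracket_g /= adV_is_linear wedge_linl lin.
move: (adL2 lambda) (adV lambda) {lin} => D2 D.
congr (_, _, _); first by rewrite /= scaler0 addr0.
  by apply/rowP => i; rewrite !mxE /=; rewrite /GRing.scale /=; ring.
apply/ffunP => i; move: (@wedge F n) => W.
by rewrite !(ext2_addE, ext2_oppE, ext2_scaleE) /GRing.scale /=; ring.
Qed.

Lemma bracket_gxx (u : g) : bracket_g u u = 0.
Proof. by move: u => [[t v] s]; rewrite /bracket_g !subrr wedgexx addr0. Qed.

Lemma bracket_gC (u v : g) : bracket_g u v = - bracket_g v u.
Proof.
move: u v => [[t1 v1] s1] [[t2 v2] s2].
rewrite /bracket_g wedgeC; congr (_, _, _); first by rewrite /= oppr0.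
  by rewrite opprB.
by rewrite opprD opprB.
Qed.

Lemma bracket_gDr (k : F) (u v w : g) :
  bracket_g u (k *: v + w) = k *: bracket_g u v + bracket_g u w.
Proof.
by rewrite bracket_gC bracket_gDl opprD -scalerN -!(bracket_gC u).
Qed.

Lemma bracket_g_jacobi (u v w : g) :
  bracket_g u (bracket_g v w) + bracket_g v (bracket_g w u)
    + bracket_g w (bracket_g u v) = 0.
Proof.
move: u v w => [[t1 v1] s1] [[t2 v2] s2] [[t3 v3] s3].
have DB (k l : F) (x y : 'rV[F]_n) : adV lambda (k *: x - l *: y)
    = k *: adV lambda x - l *: adV lambda y.
  by rewrite /adV mulmxBl !scalemxAl.
have D2E (k l : F) (x y : 'rV[F]_n) (s s' : ext2 F n) :
    adL2 lambda (wedge x y + (k *: s - l *: s')) =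
    wedge (adV lambda x) y + wedge x (adV lambda y)
      + (k *: adL2 lambda s - l *: adL2 lambda s').
  have lin r (z z' : ext2 F n) :
    adL2 lambda (r *: z + z') = r *: adL2 lambda z + adL2 lambda z'.
    exact: ext2_lift_linear.
  rewrite -adL2_wedge [_ + (k *: s - _)]addrC -addrA lin -scaleNr lin.
  by rewrite scaleNr addrA addrC.
have g3E (t t' t'' : F^o) (x x' x'' : 'rV[F]_n) (s s' s'' : ext2 F n) :
    t + t' + t'' = 0 -> x + x' + x'' = 0 -> s + s' + s'' = 0 ->
    ((t, x, s) : g) + ((t', x', s') : g) + ((t'', x'', s'') : g) = 0.
  by move=> et ex es; rewrite -[RHS]/(0, 0, 0) -et -ex -es.
rewrite /bracket_g; apply: g3E; move: DB D2E;
  move: (adL2 lambda) (adV lambda) => D2 D DB D2E.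
- by rewrite !addr0.
- rewrite !DB; apply/rowP => i; rewrite !mxE.
  by rewrite /GRing.scale /=; ring.
- rewrite !D2E; apply/ffunP => i; rewrite [RHS]ffunE; move: D2E.
  move: (@wedge F n) (@wedgeE F n) => W WE _.
  rewrite !(ext2_addE, ext2_oppE, ext2_scaleE) !WE !mxE; ring.
Qed.
End LieAxioms.

HB.instance Definition _ (F : fieldType) (n : nat) (lambda : F) :=
  Lmodule_isLieAlgebra.Build F (lie_g n lambda)
    (@bracket_gDl F n lambda) (@bracket_gDr F n lambda)
    (@bracket_gxx F n lambda) (@bracket_g_jacobi F n lambda).

Definition block3 (F : fieldType) (a b c : nat)
    (A11 : 'M[F]_(a, a)) (A12 : 'M[F]_(a, b)) (A13 : 'M[F]_(a, c))
    (A21 : 'M[F]_(b, a)) (A22 : 'M[F]_(b, b)) (A23 : 'M[F]_(b, c))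
    (A31 : 'M[F]_(c, a)) (A32 : 'M[F]_(c, b)) (A33 : 'M[F]_(c, c)) :
    'M[F]_(a + b + c) :=
  block_mx (block_mx A11 A12 A21 A22) (col_mx A13 A23) (row_mx A31 A32) A33.

Section Rabc.
Variables (F : fieldType) (n : nat) (lambda alpha : F) (a b c : nat).
Variables (M : 'M[F]_(a, b)) (N : 'M[F]_(b, c)).

(* R(x), R(v_k), R on V and on the exterior square, and R itself. *)
Definition R_x : 'M[F]_(a + b + c) :=
  block3 (jordan a alpha) 0                           0
         0                (jordan b (alpha - lambda)) 0
         0                0                           (jordan c (alpha - 2 * lambda)).

Definition R_vk (k : nat) : 'M[F]_(a + b + c) :=
  iter k (fun X => mxcomm R_x X - lambda *: X)
    (block3 0 M 0
            0 0 N
            0 0 0).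

Definition R_V (v : 'rV[F]_n) : 'M[F]_(a + b + c) :=
  \sum_(k < n) v 0 k *: R_vk k.

Definition R_L2 : ext2 F n -> 'M[F]_(a + b + c) :=
  ext2_lift (fun v w => mxcomm (R_V v) (R_V w)).

Definition R_fun (u : lie_g n lambda) : 'M[F]_(a + b + c) :=
  let: (t, v, s) := u in t *: R_x + R_V v + R_L2 s.

Lemma R_V_linear k v w : R_V (k *: v + w) = k *: R_V v + R_V w.
Proof.
rewrite /R_V scaler_sumr -big_split; apply: eq_bigr => i _ /=.
by rewrite !mxE scalerDl scalerA.
Qed.

Lemma R_fun_linear : linear R_fun.
Proof.
move=> k [[t v] s] [[t' v'] s']; rewrite /R_fun /= R_V_linear /R_L2.
rewrite ext2_lift_linear !scalerDr scalerDl -[(k *: t) *: _]scalerA.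
by rewrite [RHS]addrACA [X in _ = X + _]addrACA.
Qed.

HB.instance Definition _ :=
  GRing.isLinear.Build F (lie_g n lambda) 'M[F]_(a + b + c) *:%R R_fun R_fun_linear.

Lemma R_V_basis (i : 'I_n) : R_V (basisV F i) = R_vk i.
Proof.
rewrite /R_V (bigD1 i) //= big1 ?addr0 => [|j ji]; rewrite !mxE eqxx /=.
  by rewrite eqxx scale1r.
by rewrite (negPf ji) scale0r.
Qed.

Lemma mxcommDl d k (X Y Z : 'M[F]_d) :
  mxcomm (k *: X + Y) Z = k *: mxcomm X Z + mxcomm Y Z.
Proof.
by rewrite /mxcomm mulmxDl mulmxDr -scalemxAl -scalemxAr scalerBr opprD addrACA.
Qed.

Lemma mxcommC d (X Y : 'M[F]_d) : mxcomm X Y = - mxcomm Y X.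
Proof. by rewrite /mxcomm opprB. Qed.

Lemma mxcommDr d k (X Y Z : 'M[F]_d) :
  mxcomm X (k *: Y + Z) = k *: mxcomm X Y + mxcomm X Z.
Proof. by rewrite mxcommC mxcommDl opprD -scalerN -!mxcommC. Qed.

Lemma mxcommxx d (X : 'M[F]_d) : mxcomm X X = 0.
Proof. exact: subrr. Qed.

Lemma mxcomm_deriv d (X Y Z : 'M[F]_d) :
  mxcomm X (mxcomm Y Z) = mxcomm (mxcomm X Y) Z + mxcomm Y (mxcomm X Z).
Proof.
rewrite /mxcomm !(mulmxBl, mulmxBr) !mulmxA.
move: (X *m Y *m Z) (X *m Z *m Y) (Y *m Z *m X) (Z *m Y *m X) (Y *m X *m Z)
  (Z *m X *m Y) => P1 P2 P3 P4 P5 P6.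
by apply/matrixP => i j; rewrite !mxE; ring.
Qed.

Lemma R_L2_wedge v w : R_L2 (wedge v w) = mxcomm (R_V v) (R_V w).
Proof.
apply: ext2_lift_wedge => [k x y z|k x y z|x]; last exact: mxcommxx.
  by rewrite R_V_linear mxcommDl.
by rewrite R_V_linear mxcommDr.
Qed.
End Rabc.

Section Block3.
Variables (F : fieldType) (a b c : nat).

Lemma block3D A11 A12 A13 A21 A22 A23 A31 A32 A33
    B11 B12 B13 B21 B22 B23 B31 B32 B33 :
  block3 A11 A12 A13 A21 A22 A23 A31 A32 A33
    + block3 B11 B12 B13 B21 B22 B23 B31 B32 B33 =
  block3 (A11 + B11) (A12 + B12) (A13 + B13)
         (A21 + B21) (A22 + B22) (A23 + B23)
         (A31 + B31) (A32 + B32) (A33 + B33) :> 'M[F]_(a + b + c).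
Proof. by rewrite /block3 !add_block_mx add_row_mx add_col_mx. Qed.

Lemma block3Z k A11 A12 A13 A21 A22 A23 A31 A32 A33 :
  k *: block3 A11 A12 A13 A21 A22 A23 A31 A32 A33 =
  block3 (k *: A11) (k *: A12) (k *: A13)
         (k *: A21) (k *: A22) (k *: A23)
         (k *: A31) (k *: A32) (k *: A33) :> 'M[F]_(a + b + c).
Proof. by rewrite /block3 !scale_block_mx scale_row_mx scale_col_mx. Qed.

Lemma block3N A11 A12 A13 A21 A22 A23 A31 A32 A33 :
  - block3 A11 A12 A13 A21 A22 A23 A31 A32 A33 =
  block3 (- A11) (- A12) (- A13) (- A21) (- A22) (- A23)
         (- A31) (- A32) (- A33) :> 'M[F]_(a + b + c).
Proof. by rewrite /block3 !opp_block_mx opp_row_mx opp_col_mx. Qed.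

Lemma block30 : block3 0 0 0 0 0 0 0 0 0 = 0 :> 'M[F]_(a + b + c).
Proof. by rewrite /block3 row_mx0 col_mx0 !block_mx0. Qed.

Lemma block3M A11 A12 A13 A21 A22 A23 A31 A32 A33
    B11 B12 B13 B21 B22 B23 B31 B32 B33 :
  block3 A11 A12 A13 A21 A22 A23 A31 A32 A33
    *m block3 B11 B12 B13 B21 B22 B23 B31 B32 B33 =
  block3 (A11 *m B11 + A12 *m B21 + A13 *m B31)
         (A11 *m B12 + A12 *m B22 + A13 *m B32)
         (A11 *m B13 + A12 *m B23 + A13 *m B33)
         (A21 *m B11 + A22 *m B21 + A23 *m B31)
         (A21 *m B12 + A22 *m B22 + A23 *m B32)
         (A21 *m B13 + A22 *m B23 + A23 *m B33)
         (A31 *m B11 + A32 *m B21 + A33 *m B31)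
         (A31 *m B12 + A32 *m B22 + A33 *m B32)
         (A31 *m B13 + A32 *m B23 + A33 *m B33) :> 'M[F]_(a + b + c).
Proof.
rewrite /block3 !mulmx_block mul_col_row mul_block_col mul_col_mx.
by rewrite mul_row_block mul_mx_row mul_row_col add_block_mx add_col_mx add_row_mx.
Qed.

End Block3.

Definition admissible (n a b c : nat) : Prop :=
  ((a + b = n + 1)%N /\ (c <= a)%N) \/ ((c + b = n + 1)%N /\ (a <= c)%N).

Section RabcLie.
Variables (F : fieldType) (n : nat) (lambda alpha : F) (a b c : nat).
Variables (M : 'M[F]_(a, b)) (N : 'M[F]_(b, c)).

Local Notation RX := (R_x lambda alpha a b c).
Local Notation Rk := (R_vk lambda alpha M N).
Local Notation RV := (@R_V F n lambda alpha a b c M N).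
Local Notation R2 := (@R_L2 F n lambda alpha a b c M N).

Definition nilstep p q (X : 'M[F]_(p, q)) : 'M[F]_(p, q) :=
  jordan p 0 *m X - X *m jordan q 0.

Lemma jordanE p (beta : F) : jordan p beta = beta%:M + jordan p 0.
Proof. by apply/matrixP => i j; rewrite !mxE mul0rn add0r. Qed.

Lemma jordan_step p q (beta gamma : F) (X : 'M[F]_(p, q)) :
  beta - gamma = lambda ->
  jordan p beta *m X - X *m jordan q gamma - lambda *: X = nilstep X.
Proof.
move=> <-; rewrite (jordanE p beta) (jordanE q gamma) mulmxDl mulmxDr.
rewrite mul_scalar_mx mul_mx_scalar /nilstep scalerBl.
move: (_ *m X) (X *m _) => Y Z.
by apply/matrixP => i j; rewrite !mxE; ring.
Qed.

Lemma R_vkE k :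
  Rk k = block3 0 (iter k (@nilstep a b) M) 0 0 0 (iter k (@nilstep b c) N) 0 0 0.
Proof.
elim: k => [//|k IHk]; rewrite /R_vk iterS -/(Rk k) IHk /mxcomm /R_x.
rewrite !block3M !(mul0mx, mulmx0, addr0, add0r) block3Z -!scaleN1r.
rewrite !block3Z !block3D !scaleN1r !scaler0 !oppr0 !addr0.
rewrite !iterS -(@jordan_step _ _ alpha (alpha - lambda)) ?subKr //.
rewrite -(@jordan_step _ _ (alpha - lambda) (alpha - 2 * lambda)) //; ring.
Qed.

Lemma nilstep_vanish p q k (X : 'M[F]_(p, q)) (i : 'I_p) (j : 'I_q) :
  (p - i.+1 + j < k)%N -> iter k (@nilstep p q) X i j = 0.
Proof.
elim: k i j => [//|k IHk] i j lt_k; rewrite iterS /nilstep; set Y := iter _ _ _.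
rewrite !mxE !big1 ?subr0 // => l _; rewrite !mxE mul0rn add0r.
  case: eqP => [jl|_]; rewrite ?mulr0 // IHk ?mul0r //; lia.
case: eqP => [li|_]; rewrite ?mul0r // IHk ?mulr0 //.
have := ltn_ord l; lia.
Qed.

Lemma nilstep_nil p q k (X : 'M[F]_(p, q)) :
  (p + q <= k.+1)%N -> iter k (@nilstep p q) X = 0.
Proof.
move=> le_k; apply/matrixP => i j; rewrite nilstep_vanish ?mxE //.
have := ltn_ord j; have := ltn_ord i; lia.
Qed.

Hypothesis habc : admissible n a b c.

Lemma R_vk_step k : mxcomm RX (Rk k) = lambda *: Rk k + Rk k.+1.
Proof. by rewrite [Rk k.+1]/R_vk iterS -/(Rk k) addrC subrK. Qed.

Lemma R_vk_n : Rk n = 0.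
Proof.
by rewrite R_vkE !nilstep_nil ?block30 //; case: habc; lia.
Qed.

Lemma R_V0 : RV 0 = 0.
Proof. by rewrite /R_V big1 // => j _; rewrite mxE scale0r. Qed.

Lemma R_V_adV v : RV (adV lambda v) = mxcomm RX (RV v).
Proof.
have basisE (i : 'I_n) :
    RV (adV lambda (basisV F i)) = mxcomm RX (RV (basisV F i)).
  rewrite R_V_basis R_vk_step; case: (ltnP i.+1 n) => [hi|hi].
    by rewrite (adV_basis lambda hi) R_V_linear !R_V_basis.
  have iE : i.+1 = n by apply/eqP; rewrite eqn_leq hi ltn_ord.
  by rewrite adV_basis_last // iE R_vk_n -[X in RV X]addr0 R_V_linear R_V_basis R_V0.
rewrite (row_sum_delta v); elim/big_rec: _ => [|i w _ IHw].
  by rewrite /adV mul0mx R_V0 /mxcomm mulmx0 mul0mx subr0.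
by rewrite adV_is_linear !R_V_linear mxcommDr basisE IHw.
Qed.

Lemma mxcomm_suml d (I : finType) (k : I -> F) (X : I -> 'M[F]_d) Y :
  mxcomm Y (\sum_i k i *: X i) = \sum_i k i *: mxcomm Y (X i).
Proof.
elim/big_rec2: _ => [|i y1 y2 _ <-]; last by rewrite mxcommDr.
by rewrite /mxcomm mulmx0 mul0mx subr0.
Qed.

Lemma R_L2_sum (I : finType) (k : I -> F) (s : I -> ext2 F n) :
  R2 (\sum_i k i *: s i) = \sum_i k i *: R2 (s i).
Proof.
elim/big_rec2: _ => [|i y1 y2 _ <-]; last by rewrite /R_L2 ext2_lift_linear.
by rewrite /R_L2 /ext2_lift big1 // => p _; rewrite ffunE scale0r.
Qed.

Lemma R_L2_adL2 s : R2 (adL2 lambda s) = mxcomm RX (R2 s).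
Proof.
rewrite /adL2 {1}/ext2_lift R_L2_sum [in RHS]/R_L2 /ext2_lift mxcomm_suml.
apply: eq_bigr => p _; congr (_ *: _).
rewrite -[X in R2 (X + _)]scale1r /R_L2 ext2_lift_linear -!/(R2 _) scale1r.
by rewrite !R_L2_wedge !R_V_adV -mxcomm_deriv.
Qed.

Lemma R_V_block v : exists X Y, RV v = block3 0 X 0 0 0 Y 0 0 0.
Proof.
rewrite /R_V; elim/big_rec: _ => [|i x _ [X [Y ->]]].
  by exists 0, 0; rewrite block30.
by rewrite R_vkE block3Z block3D !scaler0 !addr0; eexists; eexists; reflexivity.
Qed.

Lemma R_L2_block s : exists P, R2 s = block3 0 0 P 0 0 0 0 0 0.
Proof.
rewrite /R_L2 /ext2_lift; elim/big_rec: _ => [|p x _ [P ->]].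
  by exists 0; rewrite block30.
have [X [Y ->]] := R_V_block (basisV F (val p).1).
have [X' [Y' ->]] := R_V_block (basisV F (val p).2).
rewrite /mxcomm !block3M !(mul0mx, mulmx0, addr0, add0r).
rewrite block3N block3D block3Z block3D !oppr0 ?(addr0, scaler0).
by eexists; reflexivity.
Qed.

Lemma R_V_L2 v s : mxcomm (RV v) (R2 s) = 0.
Proof.
have [X [Y ->]] := R_V_block v; have [P ->] := R_L2_block s.
by rewrite /mxcomm !block3M !(mul0mx, mulmx0, addr0, add0r) block30 subrr.
Qed.

Lemma R_L2_L2 s t : mxcomm (R2 s) (R2 t) = 0.
Proof.
have [P ->] := R_L2_block s; have [Q ->] := R_L2_block t.
by rewrite /mxcomm !block3M !(mul0mx, mulmx0, addr0, add0r) block30 subrr.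
Qed.

Lemma R_fun_bracket (u w : lie_g n lambda) :
  R_fun alpha M N (bracket_g u w) =
  mxcomm (R_fun alpha M N u) (R_fun alpha M N w).
Proof.
move: u w => [[t v] s] [[t' v'] s']; rewrite /R_fun /bracket_g.
have R2D k x y : R2 (k *: x + y) = k *: R2 x + R2 y.
  exact: ext2_lift_linear.
have RVB : RV (t *: adV lambda v' - t' *: adV lambda v) =
    t *: mxcomm RX (RV v') - t' *: mxcomm RX (RV v).
  have RVZ k x : RV (k *: x) = k *: RV x.
    by rewrite -[k *: x]addr0 R_V_linear R_V0 addr0.
  by rewrite -scaleNr R_V_linear RVZ !R_V_adV scaleNr.
have R2B : R2 (wedge v v' + (t *: adL2 lambda s' - t' *: adL2 lambda s)) =
    mxcomm (RV v) (RV v') + (t *: mxcomm RX (R2 s') - t' *: mxcomm RX (R2 s)).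
  have R20 : R2 0 = 0.
    by rewrite /R_L2 /ext2_lift big1 // => p _; rewrite ffunE scale0r.
  have R2Z k x : R2 (k *: x) = k *: R2 x by rewrite -[k *: x]addr0 R2D R20 addr0.
  rewrite -[wedge v v']scale1r R2D scale1r R_L2_wedge -scaleNr R2D R2Z.
  by rewrite !R_L2_adL2 scaleNr.
rewrite RVB R2B scale0r add0r.
have cDl (X Y Z : 'M[F]_(a + b + c)) : mxcomm (X + Y) Z = mxcomm X Z + mxcomm Y Z.
  by rewrite -[X]scale1r mxcommDl !scale1r.
have cDr (X Y Z : 'M[F]_(a + b + c)) : mxcomm Z (X + Y) = mxcomm Z X + mxcomm Z Y.
  by rewrite -[X]scale1r mxcommDr !scale1r.
have cZl k (X Y : 'M[F]_(a + b + c)) : mxcomm (k *: X) Y = k *: mxcomm X Y.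
  by rewrite /mxcomm -scalemxAl -scalemxAr scalerBr.
have cZr k (X Y : 'M[F]_(a + b + c)) : mxcomm Y (k *: X) = k *: mxcomm Y X.
  by rewrite /mxcomm -scalemxAl -scalemxAr scalerBr.
rewrite !(cDl, cDr) !(cZl, cZr) mxcommxx R_L2_L2 R_V_L2.
rewrite [mxcomm (R2 s) (RV v')]mxcommC R_V_L2.
rewrite [mxcomm (RV v) RX]mxcommC [mxcomm (R2 s) RX]mxcommC.
move: (mxcomm _ (RV v)) (mxcomm _ (R2 s)) (mxcomm _ (R2 s')) (mxcomm RX (RV v'))
  (mxcomm (RV v) (RV v')) => C1 C2 C3 C4 C5.
by apply/matrixP => i j; rewrite !mxE; ring.
Qed.

End RabcLie.

Section Rabc_repr.
Variables (F : fieldType) (n : nat) (lambda alpha : F) (a b c : nat).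
Variable habc : admissible n a b c.
Variables (M : 'M[F]_(a, b)) (N : 'M[F]_(b, c)).

Definition R_abc : representation (lie_g n lambda) (a + b + c) :=
  Repr (repr_fun := @R_fun F n lambda alpha a b c M N)
    (R_fun_bracket alpha M N habc).

Lemma R_abc_x : R_abc (1, 0, 0) = R_x lambda alpha a b c.
Proof.
rewrite /= /R_fun R_V0 scale1r addr0 /R_L2 /ext2_lift big1 ?addr0 // => p _.
by rewrite ffunE scale0r.
Qed.

Lemma R_abc_v (k : 'I_n) : R_abc (0, basisV F k, 0) = R_vk lambda alpha M N k.
Proof.
rewrite /= /R_fun R_V_basis scale0r add0r /R_L2 /ext2_lift big1 ?addr0 // => p _.
by rewrite ffunE scale0r.
Qed.

Lemma R_abc_wedge (v w : 'rV[F]_n) :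
  R_abc (0, 0, wedge v w) = mxcomm (R_abc (0, v, 0)) (R_abc (0, w, 0)).
Proof.
rewrite -repr_bracket; congr (R_abc _).
rewrite /lie_bracket /= !scale0r !subrr addr0 //.
Qed.
End Rabc_repr.

(* Main.v *)
Require Import Defs.
From mathcomp Require Import all_boot all_order all_algebra.
From mathcomp Require Import ring zify.

Set Implicit Arguments.
Unset Strict Implicit.
Unset Printing Implicit Defensive.

Import GRing.Theory.
Local Open Scope ring_scope.

(** Give the (i, j) entry of a block the degree j - i. Then ad A - lambda raises
    degrees by one, so M_k and N_k, the blocks of R(v_k), live in degrees at
    least k - (a - 1) and k - (b - 1), and in the lowest degree their entries
    are signed binomial multiples of M_{a,1} and N_{b,1}. Since M_i N_j lives in
    degrees at least i + j - (a + b - 2), v_{n-2} /\ v_{n-1} is killed unless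
    2n <= a + b + c, which leaves only the four listed triples. Conversely, a
    lowest degree argument turns a relation sum t_ij M_i N_j = 0 with t
    antisymmetric into a recurrence between the t_ij with i + j fixed, whose
    only antisymmetric solution is 0 when (a, b, c) is one of these triples. *)

(** * Lowest-degree entries of the iterates of [nilstep] *)

Section Nilstep.
Variables (F : fieldType).

Lemma nilstepE p q (X : 'M[F]_(p, q)) (r : 'I_p) (s : 'I_q) :
  nilstep X r s = \sum_(l < p | l == r.+1 :> nat) X l s
                  - \sum_(l < q | s == l.+1 :> nat) X r l.
Proof.
rewrite /nilstep !mxE; congr (_ - _); rewrite [RHS]big_mkcond /=;
  apply: eq_bigr => l _; rewrite mxE mul0rn add0r; case: eqP => _;
  by rewrite ?mul1r ?mulr1 ?mul0r ?mulr0.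
Qed.

(** [nilstep] is the difference of two commuting operators, left and right multiplication by a
    nilpotent Jordan block; this entry reaches the corner only through [s] right factors among [k].
    The induction is Pascal's rule. *)
Lemma nilstep_lead p q k (X : 'M[F]_(p, q)) (hp : (0 < p)%N) (hq : (0 < q)%N)
    (r : 'I_p) (s : 'I_q) : (p - r.+1 + s = k)%N ->
  iter k (@nilstep F p q) X r s
    = (-1) ^+ s * 'C(k, s)%:R * X (last_ord hp) (first_ord hq).
Proof.
elim: k r s => [|k IHk] r s rsk.
  have -> : r = last_ord hp by apply/val_inj; have := ltn_ord r => /=; lia.
  have -> : s = first_ord hq by apply/val_inj => /=; lia.
  by rewrite /= expr0 !mul1r.
rewrite iterS nilstepE; set x := X _ _.
have -> : \sum_(l < p | l == r.+1 :> nat) iter k (@nilstep F p q) X l s =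
    (-1) ^+ s * 'C(k, s)%:R * x.
  case: (ltnP r.+1 p) => hr.
    rewrite (big_pred1 (Ordinal hr)) => [|l]; last by rewrite /= -val_eqE.
    by rewrite IHk //=; lia.
  rewrite big_pred0 => [|l]; last by have := ltn_ord l; lia.
  (* In the last row [s = k + 1], so the binomial vanishes like the empty sum. *)
  by rewrite bin_small ?mulr0 ?mul0r //; lia.
case: (nat_of_ord s) (ltn_ord s) rsk => [|m] hm rsk.
  by rewrite big_pred0 ?subr0 ?bin0 // => l; lia.
have hm' : (m < q)%N by lia.
rewrite (big_pred1 (Ordinal hm')) => [|l]; last by rewrite /= -val_eqE /= eqSS eq_sym.
rewrite IHk /=; last by lia.
by rewrite -/x binS natrD exprS; ring.
Qed.

(** * Products of an iterate of [M] with an iterate of [N] *)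

Section Product.
Variables (a b c : nat) (M : 'M[F]_(a, b)) (N : 'M[F]_(b, c)).
Local Notation Mk k := (iter k (@nilstep F a b) M).
Local Notation Nk k := (iter k (@nilstep F b c) N).

(** The inner index [l] cancels: two nonzero factors need [i <= a - 1 - r + l] and
    [j <= b - 1 - l + q], hence [i + j <= a + b + c - 3]. *)
Lemma nilstep_mul_nil i j : (a + b + c <= i + j + 2)%N -> Mk i *m Nk j = 0.
Proof.
move=> le_ij; apply/matrixP => r q; rewrite !mxE big1 // => l _.
have := (ltn_ord r, ltn_ord q, ltn_ord l) => -[[lr lq] ll].
case: (ltnP (a - r.+1 + l) i) => hi.
  by rewrite nilstep_vanish ?mul0r.
by rewrite [X in _ * X]nilstep_vanish ?mulr0 //; lia.
Qed.

(* Entry (a - 1 - k, q) of the relation has degree S - (a + b - 2) for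
   S = k + q + b - 1, which only the terms with i + j <= S reach. *)
Lemma lead_relation n (t : nat -> nat -> F) (ha : (0 < a)%N) (hb : (0 < b)%N)
    (hc : (0 < c)%N) k q :
  M (last_ord ha) (first_ord hb) != 0 -> N (last_ord hb) (first_ord hc) != 0 ->
  \sum_(i < n) \sum_(j < n) t i j *: (Mk i *m Nk j) = 0 ->
  (k < a)%N -> (q < c)%N -> (k + b <= n)%N -> (q + b <= n)%N ->
  (forall i j, (i < n)%N -> (j < n)%N -> (i + j < k + q + b.-1)%N -> t i j = 0) ->
  \sum_(l < b) (-1) ^+ l * ('C(k + l, l) * 'C(q + b.-1 - l, q))%:R
     * t (k + l)%N (q + b.-1 - l)%N = 0.
Proof.
set m := M _ _; set v := N _ _ => m0 v0 rel ka qc kn qn low.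
have ra : (a - k.+1 < a)%N by lia.
(* This factor is common to all the leading terms. *)
apply: (@mulfI _ (m * v * (-1) ^+ q)).
  by rewrite !mulf_neq0 // signr_eq0.
rewrite mulr0 mulr_sumr.
transitivity ((\sum_(i < n) \sum_(j < n) t i j *: (Mk i *m Nk j))
    (Ordinal ra) (Ordinal qc)); last by rewrite rel mxE.
rewrite summxE.
transitivity (\sum_(l < b) \sum_(i < n) \sum_(j < n)
    t i j * (Mk i (Ordinal ra) l * Nk j l (Ordinal qc))); last first.
  rewrite exchange_big; apply: eq_bigr => i _ /=; rewrite summxE exchange_big.
  by apply: eq_bigr => j _ /=; rewrite !mxE mulr_sumr.
apply: eq_bigr => l _; have lb := ltn_ord l.
have hi : (k + l < n)%N by lia.
have hj : (q + b.-1 - l < n)%N by lia.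
(* When [low] does not apply, [i + j] is at least [(k + l) + (q + b - 1 - l)], so a different pair
   exceeds one of these two indices and the matching factor vanishes. *)
have zero (i j : 'I_n) : (i, j) != (Ordinal hi, Ordinal hj) ->
    t i j * (Mk i (Ordinal ra) l * Nk j l (Ordinal qc)) = 0.
  move=> ne; case: (ltnP (i + j) (k + q + b.-1)) => ij; first by rewrite low ?mul0r.
  case: (ltnP (k + l) i) => hik.
    by rewrite nilstep_vanish ?(mul0r, mulr0) //=; lia.
  rewrite [X in _ * (_ * X)]nilstep_vanish ?mulr0 //=.
  move: ne; rewrite xpair_eqE -!val_eqE /=; lia.
rewrite (bigD1 (Ordinal hi)) //= [X in _ = _ + X]big1 ?addr0 => [|i ne]; last first.
  by apply: big1 => j _; apply: zero; rewrite xpair_eqE (negPf ne).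
rewrite (bigD1 (Ordinal hj)) //= [X in _ = _ + X]big1 ?addr0 => [|j ne]; last first.
  by apply: (zero (Ordinal hi) j); rewrite xpair_eqE (negPf ne) andbF.
rewrite !(nilstep_lead _ ha hb, nilstep_lead _ hb hc) /=; try lia.
by rewrite -/m -/v natrM; ring.
Qed.

End Product.

Hypothesis charF0 : [pchar F] =i pred0.

Lemma natr_neq0 k : (0 < k)%N -> k%:R != 0 :> F.
Proof. by rewrite (proj1 (pcharf0P F) charF0) lt0n. Qed.

(** The iterates start in distinct degrees, so the relation is triangular, with pivots that are
    nonzero in characteristic 0. *)
Lemma nilstep_free p q n (X : 'M[F]_(p, q)) (hp : (0 < p)%N) (hq : (0 < q)%N)
    (v : 'rV[F]_n) :
  X (last_ord hp) (first_ord hq) != 0 -> (n < p + q)%N ->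
  \sum_(k < n) v 0 k *: iter k (@nilstep F p q) X = 0 -> v = 0.
Proof.
move=> x0 npq rel.
suff v0 m : forall k : 'I_n, (k < m)%N -> v 0 k = 0.
  by apply/rowP => k; rewrite mxE (v0 n).
elim: m => [//|m IHm] k; rewrite ltnS leq_eqVlt => /orP[/eqP km|]; last exact: IHm.
have kn := ltn_ord k.
(* Picks an entry of lowest degree for the [k]-th iterate; it fits in the matrix because
   [k <= p + q - 2]. *)
have hs : (minn k q.-1 < q)%N by lia.
have hr : (p - (k - minn k q.-1).+1 < p)%N by lia.
have := congr1 (fun X : 'M_(p, q) => X (Ordinal hr) (Ordinal hs)) rel.
rewrite mxE summxE (bigD1 k) //= big1 ?addr0 => [|i ik]; last first.
  rewrite mxE; case: (ltngtP i k) => [lt_ik|lt_ki|/val_inj eq_ik].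
  - by rewrite IHm ?mul0r // -km.
  - by rewrite nilstep_vanish ?mulr0 //=; lia.
  - by rewrite eq_ik eqxx in ik.
rewrite mxE (nilstep_lead _ hp hq) /=; last by lia.
move/eqP; rewrite !mulf_eq0 signr_eq0 (negPf x0) /= orbF => /orP[/eqP //|].
by rewrite (negPf (natr_neq0 _)) // bin_gt0; lia.
Qed.

(** * Antisymmetric solutions of the recurrence *)

Section Antisymmetric.
Variables (n : nat) (t : nat -> nat -> F).
Hypothesis tC : forall i j, t i j = - t j i.

Lemma antisym_diag i : t i i = 0.
Proof.
apply/eqP; have /eqP := tC i i; rewrite -addr_eq0 -mulr2n -mulr_natr mulf_eq0.
by rewrite (negPf (natr_neq0 _)) // orbF.
Qed.

(** The recurrence moves [(i, j)] inwards along [i + j = S], down to the diagonal, where [t] is 0,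
    or to neighbours, where it says [t j j.+1 = t j.+1 j] and antisymmetry concludes. *)
Lemma antisym_recurrence S :
  (forall k q, (k.+1 < n)%N -> (q.+1 < n)%N -> (k + q).+1 = S ->
     q.+1%:R * t k q.+1 = k.+1%:R * t k.+1 q) ->
  forall i j, (i < n)%N -> (j < n)%N -> (i + j = S)%N -> t i j = 0.
Proof.
move=> rec.
suff up d : forall i j, (i < n)%N -> (j < n)%N -> (i + j = S)%N ->
    (i <= j)%N -> (j - i <= d)%N -> t i j = 0.
  move=> i j hi hj ij; case: (leqP i j) => [le_ij|/ltnW le_ji].
    exact: (up (j - i)%N).
  by rewrite tC (up (i - j)%N) ?oppr0 // addnC.
elim/ltn_ind: d => d IHd i j hi hj ij; rewrite leq_eqVlt => /orP[/eqP <-|lt_ij] le_d.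
  exact: antisym_diag.
case: j => [//|j] in hj ij lt_ij le_d *.
have e := rec i j ltac:(lia) hj ltac:(lia).
have /natr_neq0 j0 : (0 < j.+1)%N by [].
move: lt_ij; rewrite ltnS leq_eqVlt => /orP[/eqP eq_ij|lt_ij].
  move: e; rewrite eq_ij => /(mulfI j0) e.
  apply/eqP; have := subrr (t j j.+1); rewrite {2}e -tC => /eqP.
  rewrite -mulr2n -mulr_natr mulf_eq0.
  by rewrite (negPf (natr_neq0 _)) // orbF.
apply: (mulfI j0); rewrite e mulr0.
by rewrite (IHd (j - i.+1)%N) ?mulr0 //; lia.
Qed.

End Antisymmetric.

Lemma antisym_relation_free n a b c (ha : (0 < a)%N) (hb : (0 < b)%N)
    (hc : (0 < c)%N) (M : 'M[F]_(a, b)) (N : 'M[F]_(b, c))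
    (t : nat -> nat -> F) :
  M (last_ord ha) (first_ord hb) != 0 -> N (last_ord hb) (first_ord hc) != 0 ->
  (forall i j, t i j = - t j i) ->
  (a, b, c) \in [:: (n, 1, n); (n - 1, 2, n - 1); (n, 1, n - 1); (n - 1, 1, n)]%N ->
  \sum_(i < n) \sum_(j < n)
    t i j *: (iter i (@nilstep F a b) M *m iter j (@nilstep F b c) N) = 0 ->
  forall i j, (i < n)%N -> (j < n)%N -> t i j = 0.
Proof.
move=> m0 v0 tC abc rel.
(* Induction on [i + j] provides the vanishing hypothesis of [lead_relation]. *)
suff tS S : forall i j, (i < n)%N -> (j < n)%N -> (i + j < S)%N -> t i j = 0.
  by move=> i j hi hj; apply: (tS (i + j).+1).
elim: S => [//|S IHS] i j hi hj; rewrite ltnS leq_eqVlt => /orP[/eqP ij|]; last exact: IHS.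
have leadr k q : (k < a)%N -> (q < c)%N -> (k + q + b.-1 = S)%N ->
    \sum_(l < b) (-1) ^+ l * ('C(k + l, l) * 'C(q + b.-1 - l, q))%:R
     * t (k + l)%N (q + b.-1 - l)%N = 0.
  move=> ka qc kqS; apply: (lead_relation m0 v0 rel) => // [||i' j' hi' hj' lt_S].
  - by move: abc; rewrite !inE !xpair_eqE; lia.
  - by move: abc; rewrite !inE !xpair_eqE; lia.
  - by apply: IHS => //; rewrite -kqS.
have b12 : (b = 1%N) \/ (b = 2%N /\ a = n.-1 /\ c = n.-1).
  by move: abc; rewrite !inE !xpair_eqE; lia.
case: b12 => [b1|[b2 [an cn]]].
  (* For [b = 1] the leading relation has a single term. *)
  have {}leadr k q : (k < a)%N -> (q < c)%N -> (k + q = S)%N -> t k q = 0.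
    move=> ka qc kqS; have := leadr k q ka qc; rewrite b1 /= big_ord1 /=.
    rewrite !(addn0, subn0) bin0 binn expr0 !mul1r; exact.
  case: (boolP ((i < a) && (j < c))%N) => [/andP[ia jc]|/negP nij].
    exact: leadr.
  case: (boolP ((j < a) && (i < c))%N) => [/andP[ja ic]|/negP nji].
    by rewrite tC leadr ?oppr0 // addnC.
  (* only i = j = n - 1 is left *)
  have -> : i = j by move: abc; rewrite !inE !xpair_eqE; lia.
  exact: antisym_diag.
(* For [b = 2] the two terms of the leading relation are the recurrence. *)
apply: (antisym_recurrence tC _ hi hj ij) => k q hk hq kqS.
have := leadr k q ltac:(lia) ltac:(lia) ltac:(lia).
rewrite b2 /= big_ord_recl big_ord1 /= /bump /= !(addn0, subn0, addn1).
rewrite subn1 /= bin0 bin1 binn muln1 mul1n binSn expr0 mul1r expr1 mulN1r mulNr.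
by move/eqP; rewrite subr_eq0 => /eqP.
Qed.

End Nilstep.

(** * Block form of [R_V] and [R_L2] *)

Section Blocks.
Variables (F : fieldType) (n : nat) (lambda alpha : F) (a b c : nat).
Variables (M : 'M[F]_(a, b)) (N : 'M[F]_(b, c)).
Local Notation Mk k := (iter k (@nilstep F a b) M).
Local Notation Nk k := (iter k (@nilstep F b c) N).

Lemma block3_inj A11 A12 A13 A21 A22 A23 A31 A32 A33
    B11 B12 B13 B21 B22 B23 B31 B32 B33 :
  block3 A11 A12 A13 A21 A22 A23 A31 A32 A33
    = block3 B11 B12 B13 B21 B22 B23 B31 B32 B33 :> 'M[F]_(a + b + c) ->
  [/\ A11 = B11, A22 = B22 & A33 = B33] /\ [/\ A12 = B12, A23 = B23 & A13 = B13].
Proof.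
by move=> /eq_block_mx[/eq_block_mx[-> -> _ ->] /eq_col_mx[-> ->] _ ->].
Qed.

Lemma R_V_sum v : R_V lambda alpha M N v =
  block3 0 (\sum_(k < n) v 0 k *: Mk k) 0 0 0 (\sum_(k < n) v 0 k *: Nk k) 0 0 0.
Proof.
rewrite /R_V; elim/big_rec3: _ => [|k X Y Z _ ->]; first by rewrite block30.
by rewrite R_vkE block3Z block3D !(scaler0, addr0).
Qed.

Lemma R_vk_comm i j :
  mxcomm (R_vk lambda alpha M N i) (R_vk lambda alpha M N j) =
  block3 0 0 (Mk i *m Nk j - Mk j *m Nk i) 0 0 0 0 0 0.
Proof.
by rewrite /mxcomm !R_vkE !block3M !(mul0mx, mulmx0, addr0, add0r) block3N
  block3D !(oppr0, addr0).
Qed.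

(** The skew-symmetric matrix of [s], indexed by all naturals so that the recurrence can shift
    indices without bound proofs. *)
Definition antisym_coef (s : ext2 F n) (i j : nat) : F :=
  \sum_p s p * (((i, j) == ((val p).1 : nat, (val p).2 : nat))%:R
                - ((j, i) == ((val p).1 : nat, (val p).2 : nat))%:R).

Lemma antisym_coefC s i j : antisym_coef s i j = - antisym_coef s j i.
Proof.
by rewrite /antisym_coef -sumrN; apply: eq_bigr => p _; rewrite -mulrN opprB.
Qed.

Lemma antisym_coefE (s : ext2 F n) (p : ltpair n) : antisym_coef s (val p).1 (val p).2 = s p.
Proof.
have lt_p (r : ltpair n) : ((val r).1 < (val r).2)%N := valP r.
have noswap (r : ltpair n) : (((val p).2 : nat, (val p).1 : nat)
    == ((val r).1 : nat, (val r).2 : nat)) = false.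
  by rewrite xpair_eqE; have := (lt_p p, lt_p r) => -[]; lia.
rewrite /antisym_coef (bigD1 p) //= eqxx noswap subr0 mulr1.
rewrite big1 ?addr0 // => r rp.
rewrite noswap subr0 xpair_eqE !val_eqE -xpair_eqE -!surjective_pairing val_eqE.
by rewrite eq_sym (negPf rp) mulr0.
Qed.

Lemma antisym_coef_sum (W : lmodType F) (X : nat -> nat -> W) s :
  \sum_(i < n) \sum_(j < n) antisym_coef s i j *: X i j =
  \sum_p s p *: (X (val p).1 (val p).2 - X (val p).2 (val p).1).
Proof.
have delta (k l : 'I_n) : \sum_(i < n) \sum_(j < n)
    (((i : nat), (j : nat)) == (k : nat, l : nat))%:R *: X i j = X k l.
  rewrite (bigD1 k) //= (bigD1 l) //= eqxx scale1r !big1 ?addr0 // => i ne.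
    by apply: big1 => j _; rewrite xpair_eqE val_eqE (negPf ne) scale0r.
  by rewrite xpair_eqE !val_eqE (negPf ne) andbF scale0r.
transitivity (\sum_p \sum_(i < n) \sum_(j < n)
    (s p * (((i : nat, j : nat) == ((val p).1 : nat, (val p).2 : nat))%:R
     - ((j : nat, i : nat) == ((val p).1 : nat, (val p).2 : nat))%:R)) *: X i j).
  rewrite [RHS]exchange_big; apply: eq_bigr => i _ /=.
  by rewrite exchange_big; apply: eq_bigr => j _ /=; rewrite scaler_suml.
apply: eq_bigr => p _; rewrite -2!delta -sumrB scaler_sumr.
apply: eq_bigr => i _; rewrite -sumrB scaler_sumr; apply: eq_bigr => j _.
by rewrite -scalerBl scalerA !xpair_eqE [X in _ - (nat_of_bool X)%:R]andbC.
Qed.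

Lemma R_L2_sumE (s : ext2 F n) : R_L2 lambda alpha M N s =
  block3 0 0 (\sum_(i < n) \sum_(j < n) antisym_coef s i j *: (Mk i *m Nk j))
         0 0 0 0 0 0.
Proof.
rewrite (antisym_coef_sum (fun i j => Mk i *m Nk j)) /R_L2 /ext2_lift.
elim/big_rec2: _ => [|p X Y _ ->]; first by rewrite block30.
by rewrite !R_V_basis R_vk_comm block3Z block3D !(scaler0, addr0).
Qed.

End Blocks.

Lemma wedge_basis_neq0 (F : fieldType) n (i j : 'I_n) : (i < j)%N ->
  wedge (basisV F i) (basisV F j) != 0.
Proof.
move=> ij; apply/eqP => /ffunP /(_ (Sub (i, j) ij)).
rewrite wedgeE !ffunE SubK /= !mxE !eqxx /= -!val_eqE /= (gtn_eqF ij) (ltn_eqF ij).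
by rewrite mulr1 mul0r subr0; apply/eqP/oner_neq0.
Qed.

Theorem theorem4p6 (F : closedFieldType) (charF0 : [pchar F] =i pred0)
  (n : nat) (hn : (1 < n)%N) (lambda : F)
  (a b c : nat) (ha : (0 < a)%N) (hb : (0 < b)%N) (hc : (0 < c)%N)
  (habc : admissible n a b c)
  (M : 'M[F]_(a, b)) (N : 'M[F]_(b, c))
  (hM : M (last_ord ha) (first_ord hb) != 0)
  (hN : N (last_ord hb) (first_ord hc) != 0)
  (alpha : F) :
  faithful (R_abc lambda alpha habc M N) <->
  (a, b, c) \in [:: (n, 1, n); (n - 1, 2, n - 1); (n, 1, n - 1); (n - 1, 1, n)]%N.
Proof.
split=> [inj|abc].
  have hi : (n - 2 < n)%N by lia.
  have hj : (n - 1 < n)%N by lia.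
  (* Admissibility and [2 * n <= a + b + c] force [b <= 2], which leaves the listed triples. *)
  have [small|big] := ltnP (a + b + c) (2 * n); last first.
    by move: (habc); rewrite /admissible !inE !xpair_eqE; lia.
  have /eqP[] := @wedge_basis_neq0 F n (Ordinal hi) (Ordinal hj) ltac:(move=> /=; lia).
  suff /inj[] : R_abc lambda alpha habc M N
    (0, 0, wedge (basisV F (Ordinal hi)) (basisV F (Ordinal hj))) =
      R_abc lambda alpha habc M N 0 by [].
  rewrite linear0 R_abc_wedge !R_abc_v R_vk_comm !nilstep_mul_nil /=; try lia.
  by rewrite subrr block30.
apply: raddf_inj => -[[t v] s].
rewrite /= /R_fun R_V_sum R_L2_sumE /R_x block3Z !block3D -block30.
rewrite !(scaler0, addr0, add0r) => /block3_inj[[ea eb ec] [eM eN rel]].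
(* Some block has size at least 2, and its superdiagonal 1 detects [t] whatever the eigenvalue. *)
have t0 : t = 0.
  have jordan0 p : (1 < p)%N -> forall beta, t *: jordan p beta = 0 -> t = 0.
    case: p => [|[|p]] // _ beta /matrixP /(_ ord0 (lift ord0 ord0)).
    by rewrite !mxE /= mulr0n add0r mulr1.
  have [a1|] := ltnP 1 a; first exact: jordan0 ea.
  have [b1 _|b1 a1] := ltnP 1 b; first exact: jordan0 eb.
  apply: jordan0 ec; move: (habc); rewrite /admissible; lia.
have v0 : v = 0.
  (* The block pair whose sizes sum to [n + 1] already detects [v]. *)
  case: habc => -[dim _].
    by apply: (nilstep_free charF0 hM _ eM); rewrite dim addn1.
  by apply: (nilstep_free charF0 hN _ eN); rewrite addnC dim addn1.
have s0 : s = 0.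
  apply/ffunP => p; rewrite ffunE -antisym_coefE.
  exact: (antisym_relation_free charF0 hM hN (antisym_coefC s) abc rel).
by rewrite t0 v0 s0.
Qed.
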